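(* Let $c>0$, $\epsilon>0$, and let $-1<\tau_1<\dots<\tau_M<1$ be the nodes of a quadrature for the bandlimit $2c$ and accuracy $\epsilon^2$. Let $R_1,\dots,R_M$ be the corresponding interpolating basis, so that $R_k(\tau_j)=\delta_{kj}$ for $k,j=1,\dots,M$. Define weights $$w_k=\int_{-1}^{1}R_k(\tau)\,d\tau,\qquad k=1,\dots,M,$$ assume $w_k\neq 0$ for all $k$, and define the integration matrix $$S_{kj}=\frac{1}{w_k}\int_{-1}^{1}\left(\int_{-1}^{\tau}R_j(s)\,ds\right)R_k(\tau)\,d\tau,\qquad k,j=1,\dots,M.$$ Then $$w_kS_{kj}+w_jS_{jk}-w_kw_j=0,\qquad k,j=1,\dots,M,$$ and the implicit Runge--Kutta scheme with nodes $\{\tau_j\}$, weights $\{w_j\}$ and integration matrix $S$ is symplectic.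
   Context: Quadrature: a quadrature for the bandlimit $2c$ and accuracy $\epsilon^2$ consists of nodes $-1<\tau_1<\dots<\tau_M<1$ and positive weights $\tilde w_1,\dots,\tilde w_M$ with the symmetry $\tau_k=-\tau_{M-k+1}$, $\tilde w_k=\tilde w_{M-k+1}$, such that $\left|\int_{-1}^1 e^{2ictx}\,dt-\sum_{k=1}^M\tilde w_k e^{2ic\tau_kx}\right|<\epsilon^2$ for all $x\in[-1,1]$. (The weights $w_k$ in the claim are defined anew by the integrals of the basis functions and need not equal $\tilde w_k$.) Interpolating basis: functions $R_k$ on $[-1,1]$ with $R_k(\tau_j)=\delta_{kj}$, of the form $R_k(x)=\sum_{l=1}^M r_{kl}e^{ic\tau_lx}$ with coefficients $r_{kl}\in\mathbb{C}$; or, alternatively, of the form $R_k(x)=\sum_{j=0}^{M-1}\alpha_{kj}\psi_j^c(x)$, where $\psi_0^c,\psi_1^c,\dots$ are the (real-valued) Prolate Spheroidal Wave Functions, i.e. the eigenfunctions of $F_c(\psi)(\omega)=\int_{-1}^1e^{icx\omega}\psi(x)\,dx$ on $L^2[-1,1]$, ordered by decreasing absolute value of the eigenvalue. The claim holds for either choice. Scheme: the implicit Runge--Kutta scheme with this tableau (normalized to the interval $[-1,1]$), applied to $\mathbf y'=\mathbf f(t,\mathbf y)$ with $\mathbf y(t_0)=\mathbf y_0$ and step parameter $h>0$ (the time interval $[t_0,t_0+2h]$ corresponding to $[-1,1]$), is $$\mathbf Y_k=\mathbf y_0+h\sum_{j=1}^M S_{kj}\,\mathbf f(t_0+h(\tau_j+1),\mathbf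 Y_j),\quad k=1,\dots,M,\qquad \mathbf y_1=\mathbf y_0+h\sum_{j=1}^M w_j\,\mathbf f(t_0+h(\tau_j+1),\mathbf Y_j).$$ The scheme is symplectic if, for every smooth Hamiltonian system $p'=-\partial H/\partial q$, $q'=\partial H/\partial p$ with $\mathbf y=(p,q)\in\mathbb{R}^{2d}$, the one-step map $\mathbf y_0\mapsto\mathbf y_1$, wherever it is defined by stage values $\mathbf Y_k$ depending smoothly on $\mathbf y_0$, preserves the symplectic form $\sum_{i=1}^d dp_i\wedge dq_i$. *)

(* Defs.v *)
From HB Require Import structures.
From mathcomp Require Import all_boot all_order all_algebra.
From mathcomp Require Import all_classical all_reals all_analysis.
From mathcomp Require Import complex.

Set Implicit Arguments.
Unset Strict Implicit.
Unset Printing Implicit Defensive.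

Import Order.TTheory GRing.Theory Num.Theory.
Import numFieldNormedType.Exports.

Local Open Scope classical_set_scope.
Local Open Scope ring_scope.

Section ComplexIntegration.
Variable R : realType.

Definition expi (x : R) : R[i] := Complex (cos x) (sin x).

Definition Cintegral (a b : R) (f : R -> R[i]) : R[i] :=
  Complex (\int[lebesgue_measure]_(x in `[a, b]) complex.Re (f x))
          (\int[lebesgue_measure]_(x in `[a, b]) complex.Im (f x)).

Definition L2_itv (f : R -> R[i]) : Prop :=
  [/\ measurable_fun `[(-1 : R), 1] (fun x => complex.Re (f x)),
      measurable_fun `[(-1 : R), 1] (fun x => complex.Im (f x)) &
      (@lebesgue_measure R).-integrable `[(-1 : R), 1]
        (fun x => (complex.Re (f x) ^+ 2 + complex.Im (f x) ^+ 2)%:E)].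

Definition ae_eq_itv (f g : R -> R[i]) : Prop :=
  {ae @lebesgue_measure R, forall x, x \in `[(-1 : R), 1] -> f x = g x}.

End ComplexIntegration.

Section Quadrature.
Variable R : realType.

(* Indices run from 0, so the reflection k |-> M - k + 1 is [rev_ord]. *)
Definition quadrature (b acc : R) (M : nat) (tau wt : 'I_M -> R) : Prop :=
  [/\ forall k, -1 < tau k < 1,
      forall j k : 'I_M, (j < k)%N -> tau j < tau k,
      forall k, 0 < wt k,
      forall k, tau k = - tau (rev_ord k) /\ wt k = wt (rev_ord k) &
      forall x : R, x \in `[-1, 1] ->
        `| Cintegral (-1) 1 (fun t => expi (b * t * x))
           - \sum_(k < M) (wt k)%:C%C * expi (b * tau k * x) |
        < acc%:C%C].

End Quadrature.

Section Prolate.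
Variable R : realType.

Definition prolate_op (c : R) (psi : R -> R[i]) (omega : R) : R[i] :=
  Cintegral (-1) 1 (fun x => expi (c * x * omega) * psi x).

(* Eigenfunctions as elements of L^2[-1,1], i.e. up to null sets. *)
Definition prolate_eigen (c : R) (lam : R[i]) (psi : R -> R[i]) : Prop :=
  [/\ L2_itv psi, ~ ae_eq_itv psi (fun=> 0) &
      ae_eq_itv (prolate_op c psi) (fun x => lam * psi x)].

(* [psi j] is the continuous representative of its L^2 class, so that its
   values at the nodes are meaningful.  The eigenvalues of the operator are
   simple: [lam] lists them without repetition, and every eigenfunction is a
   multiple of one of the [psi j].  No normalization of [psi j] is imposed. *)
Definition pswf (c : R) (lam : nat -> R[i]) (psi : nat -> R -> R) : Prop :=
  [/\ forall j, {within `[(-1 : R), 1], continuous (psi j)},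
      forall j, prolate_eigen c (lam j) (fun x => (psi j x)%:C%C),
      forall j, `|lam j.+1| <= `|lam j|,
      injective lam &
      forall mu phi, prolate_eigen c mu phi ->
        exists j a, mu = lam j /\ ae_eq_itv phi (fun x => a * (psi j x)%:C%C)].

End Prolate.

Section Basis.
Variable R : realType.

Definition exp_span (c : R) (M : nat) (tau : 'I_M -> R)
    (Rb : 'I_M -> R -> R[i]) : Prop :=
  exists r : 'M[R[i]]_M, forall k (x : R), x \in `[-1, 1] ->
    Rb k x = \sum_(l < M) r k l * expi (c * tau l * x).

Definition pswf_span (c : R) (M : nat) (Rb : 'I_M -> R -> R[i]) : Prop :=
  exists lam psi, pswf c lam psi /\
  exists alpha : 'M[R[i]]_M, forall k (x : R), x \in `[-1, 1] ->
    Rb k x = \sum_(j < M) alpha k j * (psi j x)%:C%C.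

Definition interpolating_basis (c : R) (M : nat) (tau : 'I_M -> R)
    (Rb : 'I_M -> R -> R[i]) : Prop :=
  (forall k j, Rb k (tau j) = (k == j)%:R) /\
  (exp_span c tau Rb \/ pswf_span c Rb).

Definition basis_weight (M : nat) (Rb : 'I_M -> R -> R[i]) (k : 'I_M) : R[i] :=
  Cintegral (-1) 1 (Rb k).

Definition integration_matrix (M : nat) (Rb : 'I_M -> R -> R[i])
    (k j : 'I_M) : R[i] :=
  (basis_weight Rb k)^-1 *
  Cintegral (-1) 1 (fun t => Cintegral (-1) t (Rb j) * Rb k t).

End Basis.

Section RungeKutta.
Variable R : realType.

Section Smoothness.
Variables V W : normedModType R.

(* All iterated directional derivatives up to order n exist and are
   differentiable (continuous at the last order) at each point of the open
   set U. *)
Fixpoint Cn_on (n : nat) (U : set V) (f : V -> W) : Prop :=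
  match n with
  | 0%N => forall x, U x -> {for x, continuous f}
  | m.+1 => (forall x, U x -> differentiable f x) /\
            (forall v, Cn_on m U (fun x => 'D_v f x))
  end.

Definition smooth_on (U : set V) (f : V -> W) : Prop := forall n, Cn_on n U f.

End Smoothness.

(* Nodes are given on [-1,1]; one step covers the time interval
   [t0, t0 + 2h]. *)
Definition rk_stages (n M : nat) (tau : 'I_M -> R) (S : 'I_M -> 'I_M -> R)
    (f : R -> 'rV[R]_n -> 'rV[R]_n) (t0 h : R) (y0 : 'rV[R]_n)
    (Y : 'I_M -> 'rV[R]_n) : Prop :=
  forall k, Y k = y0 + h *: \sum_(j < M) S k j *: f (t0 + h * (tau j + 1)) (Y j).

Definition rk_step (n M : nat) (tau w : 'I_M -> R)
    (f : R -> 'rV[R]_n -> 'rV[R]_n) (t0 h : R) (y0 : 'rV[R]_n)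
    (Y : 'I_M -> 'rV[R]_n) : 'rV[R]_n :=
  y0 + h *: \sum_(j < M) w j *: f (t0 + h * (tau j + 1)) (Y j).

(* Phase space: y = (p, q) with p the first d coordinates. *)
Definition hamiltonian_field (d : nat) (H : R -> 'rV[R]_(d + d) -> R)
    (t : R) (y : 'rV[R]_(d + d)) : 'rV[R]_(d + d) :=
  row_mx (\row_(i < d) - 'D_(delta_mx 0 (rshift d i)) (H t) y)
         (\row_(i < d) 'D_(delta_mx 0 (lshift d i)) (H t) y).

(* The form sum_i dp_i /\ dq_i evaluated on the pair (u, v). *)
Definition symplectic_form (d : nat) (u v : 'rV[R]_(d + d)) : R :=
  \sum_(i < d) (u 0 (lshift d i) * v 0 (rshift d i)
                - v 0 (lshift d i) * u 0 (rshift d i)).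

Definition preserves_symplectic_form (d : nat)
    (Phi : 'rV[R]_(d + d) -> 'rV[R]_(d + d)) (y : 'rV[R]_(d + d)) : Prop :=
  differentiable Phi y /\
  forall u v, symplectic_form ('d Phi y u) ('d Phi y v) = symplectic_form u v.

(* The Hamiltonian may depend on time.  The implicit equations need not be
   uniquely solvable, so the one-step map is the one determined by a smooth
   selection Y of stage values on an open set U of initial values. *)
Definition rk_symplectic (M : nat) (tau w : 'I_M -> R)
    (S : 'I_M -> 'I_M -> R) : Prop :=
  forall (d : nat) (H : R -> 'rV[R]_(d + d) -> R) (t0 h : R)
         (U : set 'rV[R]_(d + d)) (Y : 'rV[R]_(d + d) -> 'I_M -> 'rV[R]_(d + d)),
    smooth_on [set: (R * 'rV[R]_(d + d))%type] (fun z => H z.1 z.2) ->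
    0 < h -> open U ->
    (forall k, smooth_on U (fun y0 => Y y0 k)) ->
    (forall y0, U y0 ->
       rk_stages tau S (hamiltonian_field H) t0 h y0 (Y y0)) ->
    forall y0, U y0 ->
      preserves_symplectic_form
        (fun y => rk_step tau w (hamiltonian_field H) t0 h y (Y y)) y0.

End RungeKutta.

(* Main.v *)
Require Import Defs.
From mathcomp Require Import all_boot all_order all_algebra.
From mathcomp Require Import all_classical all_reals all_analysis.
From mathcomp Require Import complex.
From mathcomp Require Import ring lra.

Import Order.TTheory GRing.Theory Num.Theory.
Import numFieldNormedType.Exports.

Local Open Scope ring_scope.

(** Write [F_k t] for the integral of [R_k] over [[-1, t]].  The relation
    [w_k S_kj + w_j S_jk = w_k w_j] is integration by parts: the left-hand
    side is the integral over [[-1, 1]] of [F_j R_k + F_k R_j = (F_j F_k)'],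
    and [F_j F_k] equals [0] at [-1] and [w_j w_k] at [1].

    For the scheme to act on real phase space its coefficients must be real.
    Both kinds of span are stable under complex conjugation: the prolate
    functions are real, and the symmetry of the nodes makes conjugation
    exchange the exponentials of [tau_l] and [- tau_l].  So the conjugate of
    [R_k] lies in the same span and takes the same values at the nodes.
    Since the [R_k] form a cardinal basis, the matrix of node values is
    invertible, an expansion is determined by its node values
    ([cardinal_coeffs_unique]), and [R_k] is its own conjugate
    on [[-1, 1]] ([interpolating_basis_real]).

    It remains to see that the relation implies symplecticity
    ([rk_symplectic_coefficients]).  Differentiate the scheme in two
    directions [u] and [v].  The derivatives [X_j] of the stages and [K_j] of
    the fields at the stages satisfy the same scheme,
    [X_j = u + h \sum_k S_jk K_k], and likewise [X'_j], [K'_j] for [v].  The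
    linearization of a Hamiltonian field is skew for the symplectic form,
    because the Hessian of the Hamiltonian is symmetric
    ([hamiltonian_field_skew], resting on [derive_comm]).  Expanding the form
    of the two derivatives of the step and eliminating [u] and [v] by the
    stage equations, the terms of order [h] vanish by skewness and those of
    order [h ^+ 2] by the relation between the coefficients
    ([rk_variation_symplectic]). *)

(** * Integrals of products with a primitive *)

Section PrimitiveSymmetry.
Local Open Scope classical_set_scope.
Local Open Scope ring_scope.

Lemma primitive_LRcontinuous (R : realType) (f : R -> R) (a b : R) :
  a < b -> {within `[a, b], continuous f} ->
  let F x := \int[lebesgue_measure]_(t in `[a, x]) f t in
  derivable_oo_LRcontinuous F a b /\ {in `]a, b[, F^`()%classic =1 f}.
Proof.
move=> ab cf F.
have [cfoo _ _] := (continuous_within_itvP f ab).1 cf.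
have intf : (@lebesgue_measure R).-integrable `[a, b]%classic (EFin \o f).
  by apply: continuous_compact_integrable cf; exact: segment_compact.
have FTC x : x \in `]a, b[ -> derivable F x 1 /\ F^`()%classic x = f x.
  move=> /[dup] xab; rewrite in_itv/= => /andP[ax xb].
  by apply: (continuous_FTC1_closed xb intf ax); exact: cfoo.
have [_ Fa Fb] := (continuous_within_itvP F ab).1
  (parameterized_integral_continuous (ltW ab) intf).
by split=> [|x /FTC[]//]; split=> // x /FTC[].
Qed.

(** The integrand of the sum is the derivative of [F * G]. *)
Lemma integral_primitive_symmetry (R : realType) (f g : R -> R) (a b : R) :
  a < b -> {within `[a, b], continuous f} -> {within `[a, b], continuous g} ->
  let F x := \int[lebesgue_measure]_(t in `[a, x]) f t in
  let G x := \int[lebesgue_measure]_(t in `[a, x]) g t in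
  \int[lebesgue_measure]_(x in `[a, b]) (F x * g x)
  + \int[lebesgue_measure]_(x in `[a, b]) (G x * f x) = F b * G b.
Proof.
move=> ab cf cg F G.
have [dF Ff] : derivable_oo_LRcontinuous F a b /\
    {in `]a, b[, F^`()%classic =1 f} := primitive_LRcontinuous _ _ _ _ ab cf.
have [dG Gg] : derivable_oo_LRcontinuous G a b /\
    {in `]a, b[, G^`()%classic =1 g} := primitive_LRcontinuous _ _ _ _ ab cg.
rewrite (Rintegration_by_parts ab cf dF Ff cg dG Gg).
have -> : F a = 0 by rewrite /F set_itv1 Rintegral_set1.
rewrite mul0r subr0.
under [X in _ + X]eq_Rintegral do rewrite mulrC.
by rewrite subrK.
Qed.

Lemma Cintegral_real (R : realType) (a b : R) (F : R -> R[i]) (f : R -> R) :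
  (forall x, x \in `[a, b] -> F x = (f x)%:C%C) ->
  Cintegral a b F = (\int[lebesgue_measure]_(x in `[a, b]%classic) f x)%:C%C.
Proof.
move=> Ff; congr Complex.
  by apply: eq_Rintegral => x; rewrite inE /= => /Ff ->.
transitivity (\int[lebesgue_measure]_(x in `[a, b]%classic) (0 : R)).
  by apply: eq_Rintegral => x; rewrite inE /= => /Ff ->.
by rewrite Rintegral_cst// mul0r.
Qed.

End PrimitiveSymmetry.

(** * Interpolating bases are real *)

Section RealBasis.
Local Open Scope classical_set_scope.
Local Open Scope ring_scope.

(** Both hypotheses say that a square matrix is a left inverse of the matrix of
    node values, and a matrix has at most one inverse. *)
Lemma cardinal_coeffs_unique (K : fieldType) (M : nat) (X : Type)
    (x : 'I_M -> X) (g : 'I_M -> X -> K) (r r' : 'M[K]_M) :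
  (forall k j, \sum_(l < M) r k l * g l (x j) = (k == j)%:R) ->
  (forall k j, \sum_(l < M) r' k l * g l (x j) = (k == j)%:R) ->
  r = r'.
Proof.
move=> rg r'g; pose G := \matrix_(l, j) g l (x j).
have inv (s : 'M[K]_M) :
    (forall k j, \sum_(l < M) s k l * g l (x j) = (k == j)%:R) -> s *m G = 1%:M.
  move=> sg; apply/matrixP => k j; rewrite !mxE -sg.
  by apply: eq_bigr => l _; rewrite mxE.
have Gr := mulmx1C (inv _ rg).
by rewrite -[r']mulmx1 -Gr mulmxA (inv _ r'g) mul1mx.
Qed.

(** The coefficients of the conjugate of [Rb k] are the conjugated coefficients
    of [Rb k] permuted by [s].  They solve the same interpolation problem, so
    they are the coefficients of [Rb k] itself. *)
Lemma interpolant_real (R : realType) (M : nat) (X : Type) (D : set X)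
    (x : 'I_M -> X) (g Rb : 'I_M -> X -> R[i]) (s : 'I_M -> 'I_M)
    (r : 'M[R[i]]_M) :
  involutive s -> (forall l t, D t -> conjc (g l t) = g (s l) t) ->
  (forall k, D (x k)) -> (forall k j, Rb k (x j) = (k == j)%:R) ->
  (forall k t, D t -> Rb k t = \sum_(l < M) r k l * g l t) ->
  forall k t, D t -> Rb k t = (complex.Re (Rb k t))%:C%C.
Proof.
move=> sK gs Dx Rx Rbr.
have conjR k t : D t ->
    conjc (Rb k t) = \sum_(l < M) (\matrix_(i, j) conjc (r i (s j))) k l * g l t.
  move=> Dt; rewrite Rbr// rmorph_sum (reindex_inj (inv_inj sK))/=.
  by apply: eq_bigr => l _; rewrite rmorphM/= gs// sK mxE.
have rE : r = \matrix_(i, j) conjc (r i (s j)).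
  apply: (@cardinal_coeffs_unique _ _ _ x g) => k j.
    by rewrite -Rbr.
  by rewrite -conjR// Rx conjc_nat.
move=> k t Dt; have : conjc (Rb k t) = Rb k t by rewrite conjR// -rE -Rbr.
by case: (Rb k t) => u v /= [] /eqP; rewrite eqNr => /eqP ->.
Qed.

Lemma conjc_expi (R : realType) (t : R) : conjc (expi t) = expi (- t).
Proof. by rewrite /expi /= cosN sinN. Qed.

Lemma continuous_Re_lincomb (R : realType) (M : nat) (D : set R)
    (g : 'I_M -> R -> R[i]) (r : 'I_M -> R[i]) :
  (forall l, {within D, continuous (fun t => complex.Re (g l t))}) ->
  (forall l, {within D, continuous (fun t => complex.Im (g l t))}) ->
  {within D, continuous (fun t => complex.Re (\sum_(l < M) r l * g l t))}.
Proof.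
move=> cRe cIm.
have -> : (fun t => complex.Re (\sum_(l < M) r l * g l t)) =
    (fun t => \sum_(l < M) (complex.Re (r l) * complex.Re (g l t)
                           - complex.Im (r l) * complex.Im (g l t))).
  apply/funext => t; rewrite raddf_sum; apply: eq_bigr => l _.
  by case: (r l) (g l t) => [? ?] [? ?].
move=> t; apply: cvg_big => [|l _]; first exact: add_continuous.
apply: cvgB; apply: cvgM; first [exact: cvg_cst|exact: cRe|exact: cIm].
Qed.

(** Conjugation permutes the exponentials by reversal of the indices, because
    the nodes are symmetric, and fixes every prolate function. *)
Lemma interpolating_basis_real (R : realType) (c : R) (M : nat)
    (tau : 'I_M -> R) (Rb : 'I_M -> R -> R[i]) :
  (forall k, tau k \in `[-1, 1]) ->
  (forall k, tau k = - tau (rev_ord k)) ->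
  interpolating_basis c tau Rb ->
  exists rb : 'I_M -> R -> R,
    (forall k, {within `[-1, 1], continuous (rb k)}) /\
    (forall k t, t \in `[-1, 1] -> Rb k t = (rb k t)%:C%C).
Proof.
move=> tauI tauN [Rx span].
have [s [g [r [sK gs [cRe cIm] Rbr]]]] :
  exists (s : 'I_M -> 'I_M) (g : 'I_M -> R -> R[i]) (r : 'M[R[i]]_M),
  [/\ involutive s,
      forall l t, conjc (g l t) = g (s l) t,
      (forall l, {within `[-1, 1], continuous (fun t => complex.Re (g l t))}) /\
      (forall l, {within `[-1, 1], continuous (fun t => complex.Im (g l t))}) &
      forall k t, t \in `[-1, 1] -> Rb k t = \sum_(l < M) r k l * g l t].
  case: span => [[r Rbr]|[lam [psi [[cpsi _ _ _ _] [r Rbr]]]]].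
    exists (@rev_ord M), (fun l t => expi (c * tau l * t)), r; split => //.
    - exact: rev_ordK.
    - by move=> l t; rewrite conjc_expi tauN mulrN mulNr opprK.
    have cl l : continuous (fun t : R => c * tau l * t).
      by move=> t; apply: cvgM; [exact: cvg_cst|exact: cvg_id].
    split=> l; apply: continuous_subspaceT => t /=.
      exact: (continuous_comp (cl l t) (@continuous_cos _ _)).
    exact: (continuous_comp (cl l t) (@continuous_sin _ _)).
  exists id, (fun l t => (psi l t)%:C%C), r; split => //.
    by move=> l t; rewrite conjc_real.
  split=> l /=; first exact: cpsi.
  exact: (@cst_continuous _ _ (0 : R)).
exists (fun k t => complex.Re (Rb k t)); split => k.
  have := @continuous_Re_lincomb _ _ `[-1, 1]%classic g (r k) cRe cIm.
  apply: subspace_eq_continuous => t; rewrite inE /= => tI.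
  by rewrite /from_subspace Rbr.
move=> t tI.
exact: (@interpolant_real _ _ _ [set` `[-1, 1]] tau g Rb s r sK _ tauI Rx Rbr).
Qed.

End RealBasis.

(** * Symmetry of second derivatives *)

Section SecondDerivatives.
Local Open Scope classical_set_scope.

(** A derivative depends only on the increments along its direction.  This
    transports derivatives between a function and its slices, its restrictions
    to lines and its translates, whether or not it is differentiable. *)
Section SameIncrements.
Context {R : realType} {V1 V2 W : normedModType R}.
Variables (f : V1 -> W) (g : V2 -> W) (x1 v1 : V1) (x2 v2 : V2).
Hypothesis fg : forall h : R, f (h *: v1 + x1) = g (h *: v2 + x2).

Let quotient_eq :
  (fun h : R => h^-1 *: ((f \o shift x1) (h *: v1) - f x1)) =
  (fun h : R => h^-1 *: ((g \o shift x2) (h *: v2) - g x2)).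
Proof.
apply/funext => h /=; rewrite fg.
by have := fg 0; rewrite !scale0r !add0r => ->.
Qed.

Lemma derive_same_increments : 'D_v1 f x1 = 'D_v2 g x2.
Proof. by rewrite /derive quotient_eq. Qed.

Lemma derivable_same_increments : derivable g x2 v2 -> derivable f x1 v1.
Proof. by rewrite /derivable quotient_eq. Qed.

End SameIncrements.

Section IteratedDerivatives.
Context {R : realType} {V W : normedModType R}.

Lemma derive_slice (G : R * V -> W) (t : R) (v : V) :
  'D_v (fun y => G (t, y)) = fun y => 'D_(0, v) G (t, y).
Proof.
apply/funext => y; apply: derive_same_increments => h.
have -> : h *: (0 : R, v) + (t, y) = (h * 0 + t, h *: v + y) by [].
by rewrite mulr0 add0r.
Qed.

Lemma differentiable_slice (G : R * V -> W) (t : R) (y : V) :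
  differentiable G (t, y) -> differentiable (fun y => G (t, y)) y.
Proof.
by move=> dG; apply: (@differentiable_comp _ _ _ _ (fun y => (t, y)) G).
Qed.

Lemma Cn_on_slice (n : nat) (G : R * V -> W) (t : R) :
  Cn_on n setT G -> Cn_on n setT (fun y => G (t, y)).
Proof.
elim: n G => [|n IH] G /=.
  move=> cG y _; apply: (@continuous_comp _ _ _ (fun y => (t, y)) G).
    exact: differentiable_continuous.
  exact: cG.
move=> [dG DG]; split=> [y _|v]; first exact/differentiable_slice/dG.
by rewrite derive_slice; apply: (IH ('D_(0, v) G)); exact: DG.
Qed.

Lemma is_derive_line (G : V -> W) (x v : V) (s : R) :
  differentiable G (x + s *: v) ->
  is_derive s 1 (fun s => G (x + s *: v)) ('D_v G (x + s *: v)).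
Proof.
move=> dG.
have inc (h : R) : G (x + (h *: 1 + s) *: v) = G (h *: v + (x + s *: v)).
  by rewrite [h *: 1]mulr1 scalerDl addrCA.
split; last exact: (@derive_same_increments R R V W _ _ _ _ _ _ inc).
apply: (@derivable_same_increments R R V W _ _ _ _ _ _ inc).
exact: diff_derivable.
Qed.

End IteratedDerivatives.

Section Schwarz.
Context {R : realType} {V : normedModType R}.

Lemma mvt_line (G : V -> R) (x v : V) (h : R) :
  0 < h -> (forall y, differentiable G y) ->
  exists2 s, 0 < s < h & G (x + h *: v) - G x = 'D_v G (x + s *: v) * h.
Proof.
move=> h0 dG.
have [|s sh] := MVT h0 (fun s _ => is_derive_line G x v s (dG _)).
  apply: derivable_within_continuous => s _.
  by have [] := is_derive_line G x v s (dG _).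
by rewrite scale0r addr0 subr0 => E; exists s => //; move: sh; rewrite in_itv.
Qed.

(** The mean value theorem is applied along [u] to the increment
    [G (y + h *: v) - G y], then along [v] to ['D_u G].  The left-hand side is
    invariant under exchange of [u] and [v], which is what gives the symmetry
    of second derivatives. *)
Lemma second_difference_mvt (G : V -> R) (x u v : V) (h : R) : 0 < h ->
  (forall y, differentiable G y) -> (forall y, differentiable ('D_u G) y) ->
  exists s t, [/\ 0 < s < h, 0 < t < h &
    G (x + h *: u + h *: v) - G (x + h *: u) - G (x + h *: v) + G x
    = 'D_v ('D_u G) (x + (s *: u + t *: v)) * h ^+ 2].
Proof.
move=> h0 dG dDG.
pose P y := G (y + h *: v) - G y.
have dsh y : differentiable (fun y => G (y + h *: v)) y.
  by apply: (@differentiable_comp _ _ _ _ (fun y => y + h *: v) G).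
have dP y : differentiable P y by apply: differentiableB.
have [s sh EP] := mvt_line P x u h h0 dP.
have DP y : 'D_u P y = 'D_u G (y + h *: v) - 'D_u G y.
  rewrite deriveB; [|exact: diff_derivable..].
  by congr (_ - _); apply: derive_same_increments => k; rewrite addrA.
have [t th ED] := mvt_line ('D_u G) (x + s *: u) v h h0 dDG.
exists s, t; split => //.
transitivity (P (x + h *: u) - P x); first by rewrite /P; ring.
by rewrite EP DP ED addrA; ring.
Qed.

Lemma small_parallelogram (D : V -> R) (x u v : V) (e : R) : 0 < e ->
  {for x, continuous D} -> exists2 d, 0 < d &
  forall s t, 0 < s < d -> 0 < t < d ->
    `|D x - D (x + (s *: u + t *: v))| < e.
Proof.
move=> e0 /cvgr_dist_lt/(_ _ e0) /nbhs_ballP[d /= d0 dD].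
(* The summand 1 keeps [m] positive when [u] and [v] both vanish. *)
pose m := `|u| + `|v| + 1.
have m0 : 0 < m by rewrite ltr_wpDl// addr_ge0.
exists (d / m) => [|s t /andP[s0 sd] /andP[t0 td]]; first by rewrite divr_gt0.
apply: dD; rewrite -ball_normE /= opprD addNKr normrN.
apply: (@le_lt_trans _ _ (Num.max s t * (`|u| + `|v|))).
  rewrite mulrDr (le_trans (ler_normD _ _))// !normrZ !gtr0_norm//.
  by rewrite lerD// ler_wpM2r// le_max lexx ?orbT.
have st0 : 0 < Num.max s t by rewrite lt_max s0.
rewrite (@lt_trans _ _ (Num.max s t * m))// ?ltr_pM2l ?ltrDl//.
by rewrite -ltr_pdivlMr// gt_max sd.
Qed.

(** Both mixed derivatives are values of the same second difference divided by
    [h ^+ 2], taken at points of a small parallelogram at [x], and both are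
    continuous at [x]. *)
Lemma derive_comm (G : V -> R) (x u v : V) :
  (forall y, differentiable G y) ->
  (forall w y, differentiable ('D_w G) y) ->
  {for x, continuous ('D_v ('D_u G))} -> {for x, continuous ('D_u ('D_v G))} ->
  'D_v ('D_u G) x = 'D_u ('D_v G) x.
Proof.
move=> dG dDG cvu cuv; apply/eqP; rewrite -subr_eq0 -normr_le0.
apply/ler_addgt0Pl => e e0; rewrite addr0.
have e2 : 0 < e / 2 by rewrite divr_gt0.
have [d1 d10 near_vu] := small_parallelogram _ x u v _ e2 cvu.
have [d2 d20 near_uv] := small_parallelogram _ x v u _ e2 cuv.
pose h := Num.min d1 d2.
have h0 : 0 < h by rewrite lt_min d10.
have h1 s : 0 < s < h -> 0 < s < d1.
  by move=> /andP[-> /lt_le_trans]; apply; rewrite ge_min lexx.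
have h2 s : 0 < s < h -> 0 < s < d2.
  by move=> /andP[-> /lt_le_trans]; apply; rewrite ge_min lexx orbT.
have [s [t [/h1 sh /h1 th E1]]] := second_difference_mvt G x u v h h0 dG (dDG u).
have [s' [t' [/h2 sh' /h2 th' E2]]] :=
  second_difference_mvt G x v u h h0 dG (dDG v).
have {E1 E2} E : 'D_v ('D_u G) (x + (s *: u + t *: v)) =
         'D_u ('D_v G) (x + (s' *: v + t' *: u)).
  apply: (mulIf (_ : h ^+ 2 != 0)); first by rewrite expf_neq0// gt_eqF.
  apply: etrans (esym E1) (etrans _ E2).
  by rewrite [x + h *: u + h *: v]addrAC; congr (_ + _); exact: addrAC.
have tri (a b m : R) : `|a - m| < e / 2 -> `|b - m| < e / 2 -> `|a - b| <= e.
  move=> am bm; apply: le_trans (ler_distD m a b) _.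
  by rewrite [e]splitr lerD ?(ltW am)// distrC ltW.
apply: tri (near_vu _ _ sh th) _.
by have := near_uv _ _ sh' th'; rewrite -E.
Qed.

End Schwarz.

End SecondDerivatives.

(** * The symplectic form and Hamiltonian fields *)

Section HamiltonianLinearization.
Local Open Scope classical_set_scope.

Section SymplecticForm.
Context {R : realType} {d : nat}.
Implicit Types a b u v : 'rV[R]_(d + d).

Lemma symplectic_formDl a b v :
  symplectic_form (a + b) v = symplectic_form a v + symplectic_form b v.
Proof.
by rewrite -big_split/=; apply: eq_bigr => i _; rewrite !mxE; ring.
Qed.

Lemma symplectic_formZl (r : R) a v :
  symplectic_form (r *: a) v = r * symplectic_form a v.
Proof. by rewrite mulr_sumr; apply: eq_bigr => i _; rewrite !mxE; ring. Qed.

Lemma symplectic_formN a b : symplectic_form a b = - symplectic_form b a.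
Proof. by rewrite -sumrN; apply: eq_bigr => i _; ring. Qed.

Lemma symplectic_formDr v a b :
  symplectic_form v (a + b) = symplectic_form v a + symplectic_form v b.
Proof.
by rewrite symplectic_formN symplectic_formDl opprD -!symplectic_formN.
Qed.

Lemma symplectic_formZr (r : R) v a :
  symplectic_form v (r *: a) = r * symplectic_form v a.
Proof. by rewrite symplectic_formN symplectic_formZl -mulrN -symplectic_formN. Qed.

Lemma symplectic_form_suml (M : nat) (c : 'I_M -> R)
    (K : 'I_M -> 'rV[R]_(d + d)) v :
  symplectic_form (\sum_(j < M) c j *: K j) v
  = \sum_(j < M) c j * symplectic_form (K j) v.
Proof.
elim/big_rec2: _ => [|j y x _ <-].
  by rewrite -(scale0r 0) symplectic_formZl mul0r.
by rewrite symplectic_formDl symplectic_formZl.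
Qed.

Lemma symplectic_form_sumr (M : nat) (c : 'I_M -> R)
    (K : 'I_M -> 'rV[R]_(d + d)) v :
  symplectic_form v (\sum_(j < M) c j *: K j)
  = \sum_(j < M) c j * symplectic_form v (K j).
Proof.
rewrite symplectic_formN symplectic_form_suml -sumrN.
by apply: eq_bigr => j _; rewrite [in RHS]symplectic_formN mulrN.
Qed.

(** Here [X], [K] and [X'], [K'] are the variations of the stages and of the
    field at the stages in the directions [u] and [v].  Each [j]-th term of
    order [h] is rewritten by the stage equations and the skewness hypothesis
    as a combination of the numbers [B i j]; summed with the weights [w j] and
    reindexed, the coefficient of [B i j] becomes
    [- (w i * S i j + w j * S j i) = - (w i * w j)], which cancels the term of
    order [h ^+ 2]. *)
Lemma rk_variation_symplectic (M : nat) (w : 'I_M -> R) (S : 'I_M -> 'I_M -> R)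
    (h : R) u v (X X' K K' : 'I_M -> 'rV[R]_(d + d)) :
  (forall k j, w k * S k j + w j * S j k = w k * w j) ->
  (forall j, X j = u + h *: \sum_(k < M) S j k *: K k) ->
  (forall j, X' j = v + h *: \sum_(k < M) S j k *: K' k) ->
  (forall j, symplectic_form (K j) (X' j) + symplectic_form (X j) (K' j) = 0) ->
  symplectic_form (u + h *: \sum_(j < M) w j *: K j)
                  (v + h *: \sum_(j < M) w j *: K' j) = symplectic_form u v.
Proof.
move=> wS XE X'E ham.
pose B i j := symplectic_form (K i) (K' j).
have stage j : symplectic_form u (K' j) + symplectic_form (K j) v
    = - (h * \sum_(k < M) (S j k * B k j + S j k * B j k)).
  have := ham j; rewrite XE X'E symplectic_formDl symplectic_formDr.
  rewrite symplectic_formZl symplectic_formZr symplectic_form_suml.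
  rewrite symplectic_form_sumr big_split/= => E; lra.
rewrite symplectic_formDl !symplectic_formDr !symplectic_formZl.
rewrite !symplectic_formZr !symplectic_form_suml !symplectic_form_sumr.
rewrite -addrA -[RHS]addr0; congr (_ + _).
have -> : h * (\sum_(j < M) w j * symplectic_form u (K' j)) +
  (h * (\sum_(j < M) w j * symplectic_form (K j) v) +
    h * (h * \sum_(j < M) w j * symplectic_form (K j) (\sum_(k < M) w k *: K' k)))
  = h * (\sum_(j < M) w j *
         (symplectic_form u (K' j) + symplectic_form (K j) v))
    + h * (h * \sum_(j < M) w j * symplectic_form (K j) (\sum_(k < M) w k *: K' k)).
  under [in RHS]eq_bigr do rewrite mulrDr.
  by rewrite big_split /=; ring.
under eq_bigr do rewrite stage.
under [X in _ + h * (h * X)]eq_bigr do rewrite symplectic_form_sumr -/(B _ _).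
rewrite -mulrDr.
suff -> : \sum_(j < M) w j * - (h * \sum_(k < M) (S j k * B k j + S j k * B j k))
  = - (h * \sum_(j < M) w j * \sum_(k < M) w k * B j k).
  by rewrite addNr mulr0.
under eq_bigr do rewrite mulrN mulrCA.
rewrite sumrN -mulr_sumr; congr (- (h * _)).
under eq_bigr do rewrite big_split mulrDr !mulr_sumr.
rewrite big_split /= exchange_big /= -big_split /=.
apply: eq_bigr => i _; rewrite mulr_sumr -big_split /=; apply: eq_bigr => j _.
by rewrite [RHS]mulrA -wS /B; ring.
Qed.

End SymplecticForm.

Lemma differentiable_rV (R : realType) (V : normedModType R) (n : nat)
    (f : V -> 'rV[R]_n) (x : V) :
  (forall j, differentiable (fun y => f y 0 j) x) -> differentiable f x.
Proof.
move=> df.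
have -> : f = \sum_(j < n) (fun y => f y 0 j *: delta_mx 0 j).
  by apply/funext => y; rewrite fct_sumE; exact: row_sum_delta.
by apply: differentiable_sum => j; exact: differentiableZl.
Qed.

Section HamiltonianField.
Context {R : realType} {d : nat}.
Variables (H : R -> 'rV[R]_(d + d) -> R) (t : R).
Hypothesis Hsmooth : smooth_on [set: (R * 'rV[R]_(d + d))%type] (fun z => H z.1 z.2).

Let smooth_slice n : Cn_on n setT (H t) := Cn_on_slice n _ t (Hsmooth n).

Let dH y : differentiable (H t) y.
Proof. by have [+ _] := smooth_slice 1; apply. Qed.

Let dDH v y : differentiable ('D_v (H t)) y.
Proof. by have [_ /(_ v)[+ _]] := smooth_slice 2; apply. Qed.

Let DDHC u v y : 'D_u ('D_v (H t)) y = 'D_v ('D_u (H t)) y.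
Proof.
have DDc a b : {for y, continuous ('D_a ('D_b (H t)))}.
  by have [_ /(_ b)[_ /(_ a y I)]] := smooth_slice 2.
exact: derive_comm dH dDH (DDc _ _) (DDc _ _).
Qed.

Lemma derive_phase_coord (g : 'rV[R]_(d + d) -> R) (y b : 'rV[R]_(d + d)) :
  differentiable g y ->
  'D_b g y = \sum_(i < d) (b 0 (lshift d i) * 'D_(delta_mx 0 (lshift d i)) g y
                         + b 0 (rshift d i) * 'D_(delta_mx 0 (rshift d i)) g y).
Proof.
move=> dg; rewrite deriveE// {1}(row_sum_delta b) linear_sum big_split_ord/=.
by rewrite -big_split; apply: eq_bigr => i _ /=; rewrite !linearZ /= !deriveE.
Qed.

Lemma hamiltonian_field_lshift (y : 'rV[R]_(d + d)) (i : 'I_d) :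
  hamiltonian_field H t y 0 (lshift d i)
  = - 'D_(delta_mx 0 (rshift d i)) (H t) y.
Proof. by rewrite row_mxEl mxE. Qed.

Lemma hamiltonian_field_rshift (y : 'rV[R]_(d + d)) (i : 'I_d) :
  hamiltonian_field H t y 0 (rshift d i)
  = 'D_(delta_mx 0 (lshift d i)) (H t) y.
Proof. by rewrite row_mxEr mxE. Qed.

Lemma differentiable_hamiltonian_field y :
  differentiable (hamiltonian_field H t) y.
Proof.
apply: differentiable_rV => j; rewrite -(fintype.splitK j).
case: (fintype.split j) => i /=.
  under eq_fun do rewrite hamiltonian_field_lshift.
  exact: differentiableN.
by under eq_fun do rewrite hamiltonian_field_rshift.
Qed.

(** The mixed derivatives are given with the coordinate derivative outermost,
    so that pairing with a vector [v] reassembles the derivative of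
    ['D_a (H t)] in the direction [v]. *)
Lemma derive_hamiltonian_field y a (i : 'I_d) :
  'D_a (hamiltonian_field H t) y 0 (lshift d i)
  = - 'D_(delta_mx 0 (rshift d i)) ('D_a (H t)) y /\
  'D_a (hamiltonian_field H t) y 0 (rshift d i)
  = 'D_(delta_mx 0 (lshift d i)) ('D_a (H t)) y.
Proof.
have dHF : derivable (hamiltonian_field H t) y a.
  exact/diff_derivable/differentiable_hamiltonian_field.
rewrite derive_mx// !mxE; split.
  under eq_fun do rewrite hamiltonian_field_lshift.
  rewrite deriveN; last exact: diff_derivable.
  exact: (congr1 -%R (DDHC a (delta_mx 0 (rshift d i)) y)).
under eq_fun do rewrite hamiltonian_field_rshift.
exact: (DDHC a (delta_mx 0 (lshift d i)) y).
Qed.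

(** The form pairs the derivative of the field along [u] with [v] to minus the
    Hessian of [H t] at [(u, v)], which is symmetric, whereas the form is
    alternating. *)
Lemma hamiltonian_field_skew y a b :
  symplectic_form ('D_a (hamiltonian_field H t) y) b
  + symplectic_form a ('D_b (hamiltonian_field H t) y) = 0.
Proof.
have pairing (p q gl gr bl br : R) : p = - gr -> q = gl ->
    p * br - bl * q = - (bl * gl + br * gr) by move=> -> ->; ring.
have hess u v : symplectic_form ('D_u (hamiltonian_field H t) y) v
    = - 'D_v ('D_u (H t)) y.
  rewrite (derive_phase_coord _ y v)// -sumrN.
  apply: eq_bigr => i _; have [El Er] := derive_hamiltonian_field y u i.
  exact: pairing El Er.
rewrite hess symplectic_formN hess opprK.
have eq_addN (p q : R) : p = q -> - p + q = 0 by move=> ->; exact: addNr.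
exact: eq_addN (DDHC b a y).
Qed.

End HamiltonianField.

End HamiltonianLinearization.

(** * Runge-Kutta steps of Hamiltonian systems *)

Section RungeKuttaStep.
Local Open Scope classical_set_scope.

(** Stages and step share this shape, with different coefficients [c], so
    this one computation gives the variational equations of both. *)
Lemma is_derive_increment (R : realType) (V W : normedModType R) (M : nat)
    (L : V -> W) (G : 'I_M -> V -> W) (c : 'I_M -> R) (h : R) (y a : V) :
  differentiable L y -> (forall j, differentiable (G j) y) ->
  differentiable (fun y => L y + h *: \sum_(j < M) c j *: G j y) y /\
  'D_a (fun y => L y + h *: \sum_(j < M) c j *: G j y) y
  = 'D_a L y + h *: \sum_(j < M) c j *: 'D_a (G j) y.
Proof.
move=> dL dG.
have -> : (fun y => L y + h *: \sum_(j < M) c j *: G j y)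
    = L + h *: \sum_(j < M) c j *: G j.
  by apply/funext => z; rewrite /= fctE/= fct_sumE.
have dcG j : differentiable (c j *: G j) y by exact: differentiableZ.
have dS : differentiable (\sum_(j < M) c j *: G j) y by exact: differentiable_sum.
have dhS := differentiableZ h dS.
split; first exact: differentiableD.
rewrite deriveD; [|exact: diff_derivable..].
rewrite deriveZ; last exact: diff_derivable.
rewrite derive_sum; last by move=> j; exact: diff_derivable.
congr (_ + _ *: _); apply: eq_bigr => j _.
by rewrite deriveZ//; exact: diff_derivable.
Qed.

(** The stage equations hold on the open set [U], hence near [y0], and may be
    differentiated there.  By the chain rule the derivative of the field at a
    stage is the linearized field applied to the variation of the stage. *)
Lemma rk_symplectic_coefficients (R : realType) (M : nat) (tau w : 'I_M -> R)
    (S : 'I_M -> 'I_M -> R) :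
  (forall k j, w k * S k j + w j * S j k = w k * w j) -> rk_symplectic tau w S.
Proof.
move=> wS d H t0 h U Y Hsmooth h0 Uopen Ysmooth stages y0 Uy0.
pose f j := hamiltonian_field H (t0 + h * (tau j + 1)).
have dY j : differentiable (Y ^~ j) y0.
  by have [/(_ y0 Uy0) ? _] := Ysmooth j 1.
have df j y : differentiable (f j) y by exact: differentiable_hamiltonian_field.
have dfY j : differentiable (fun y => f j (Y y j)) y0.
  exact: (@differentiable_comp _ _ _ _ (Y ^~ j) (f j)).
pose X a j := 'D_a (Y ^~ j) y0.
pose K a j := 'D_a (fun y => f j (Y y j)) y0.
have KE a j : K a j = 'D_(X a j) (f j) (Y y0 j).
  rewrite /K /X deriveE// [in RHS]deriveE// [in RHS]deriveE//.
  exact: (congr1 (@^~ a) (diff_comp (dY j) (df j (Y y0 j)))).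
have step c a : differentiable
      (fun y => y + h *: \sum_(j < M) c j *: f j (Y y j)) y0 /\
    'D_a (fun y => y + h *: \sum_(j < M) c j *: f j (Y y j)) y0
    = a + h *: \sum_(j < M) c j *: K a j.
  have := @is_derive_increment _ _ _ M id (fun j y => f j (Y y j)) c h y0 a.
  by rewrite derive_id; apply.
have XE a k : X a k = a + h *: \sum_(j < M) S k j *: K a j.
  rewrite -(step (S k) a).2; apply: near_eq_derive.
  have : nbhs y0 U by exact: open_nbhs_nbhs.
  by apply: filterS => y Uy; exact: stages.
have [dstep _] := step w 0; split=> // u v.
rewrite -!deriveE//.
have stepE a : 'D_a (fun y => rk_step tau w (hamiltonian_field H) t0 h y (Y y)) y0
    = a + h *: \sum_(j < M) w j *: K a j by exact: (step w a).2.
rewrite !stepE.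
apply: (rk_variation_symplectic _ w S h u v (X u) (X v) _ _ wS (XE u) (XE v)).
move=> j; rewrite !KE; exact: hamiltonian_field_skew.
Qed.

End RungeKuttaStep.

Theorem theorem5 (R : realType) (c eps : R) (M : nat) (tau wt : 'I_M -> R)
    (Rb : 'I_M -> R -> R[i])
    (c_gt0 : 0 < c) (eps_gt0 : 0 < eps)
    (quad : quadrature (2 * c) (eps ^+ 2) tau wt)
    (basis : interpolating_basis c tau Rb)
    (w_neq0 : forall k : 'I_M, basis_weight Rb k != 0) :
  let w := basis_weight Rb in
  let S := integration_matrix Rb in
  (forall k j : 'I_M, w k * S k j + w j * S j k - w k * w j = 0) /\
  (exists (wR : 'I_M -> R) (SR : 'I_M -> 'I_M -> R),
     [/\ forall k, w k = (wR k)%:C%C,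
         forall k j, S k j = (SR k j)%:C%C &
         rk_symplectic tau wR SR]).
Proof.
move=> w S.
have [tauI _ _ tauN _] := quad.
have tau_itv k : tau k \in `[-1, 1].
  by have /andP[lo hi] := tauI k; rewrite in_itv/= !ltW.
have [rb [crb Rbrb]] :=
  interpolating_basis_real _ _ _ _ _ tau_itv (fun k => (tauN k).1) basis.
pose prim j x := \int[lebesgue_measure]_(t in `[-1, x]%classic) rb j t.
pose A k j := \int[lebesgue_measure]_(x in `[-1, 1]%classic) (prim j x * rb k x).
pose wR k := prim k 1.
have wE k : w k = (wR k)%:C%C by exact: Cintegral_real (Rbrb k).
have wR0 k : wR k != 0.
  by have := w_neq0 k; rewrite -/(w k) wE; apply: contra => /eqP ->.
pose SR k j := (wR k)^-1 * A k j.
have SE k j : S k j = (SR k j)%:C%C.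
  rewrite /S /integration_matrix -/(w k) wE /SR rmorphM fmorphV; congr (_ * _).
  apply: Cintegral_real => x x_itv; rewrite Rbrb// rmorphM; congr (_ * _).
  apply: Cintegral_real => t t_itv; apply: Rbrb.
  move: x_itv t_itv; rewrite !in_itv /= => /andP[_ x1] /andP[-> tx].
  exact: le_trans tx x1.
have wSR k j : wR k * SR k j + wR j * SR j k = wR k * wR j.
  rewrite !mulVKf// [RHS]mulrC.
  have N11 : -1 < 1 :> R by lra.
  exact: integral_primitive_symmetry N11 (crb j) (crb k).
split=> [k j|]; first by rewrite !wE !SE -!rmorphM -rmorphD -rmorphB wSR subrr.
exists wR, SR; split; [exact: wE|exact: SE|].
exact: rk_symplectic_coefficients.
Qed.
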